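(* Let $C = 1.25506$. For every integer $n \geq 1123$, the number of primes $p$ with $n < p < 2n$ is at least $$\left\lfloor \frac{1}{C}\left(\log 4 - C - \frac{\log 2\,\log 4}{\log(2n)}\right)\pi(n) \right\rfloor ,$$ where $\pi(n)$ denotes the number of primes less than or equal to $n$.
   Context: $\log$ denotes the natural logarithm; $\pi$ is the prime counting function. *)

(* Defs.v *)
From mathcomp Require Import all_boot all_order all_algebra.
From mathcomp Require Import all_classical all_reals all_analysis.
Set Implicit Arguments.
Unset Strict Implicit.
Unset Printing Implicit Defensive.
Import Order.TTheory GRing.Theory Num.Theory.
Local Open Scope ring_scope.

Definition prime_pi (n : nat) : nat := #|[set p : 'I_n.+1 | prime p]%SET|.

(* A p with m < p < n is an element of 'I_n. *)
Definition primes_between (m n : nat) : nat :=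
  #|[set p : 'I_n | prime p & (m < p < n)%N]%SET|.

(* The decimal 1.25506, written without a large unary numeral. *)
Definition chebC (R : realType) : R := 1 + 25 / 10 ^+ 2 + 506 / 10 ^+ 5.

(* Main.v *)
(* Erdos's argument. Since 4^n <= 2n C(2n,n), it is enough to bound C(2n,n)
   from above. Its primes p <= s = floor (sqrt (2n)) contribute at most 2n each,
   those in (s, 2n/3] at most p each (so at most 4^(2n/3) altogether), those in
   (2n/3, n] nothing, and those in (n, 2n) at most 2n each. With L = ln (2n) this
   leaves at least (2/3) ln 2 n / L - sqrt (2n) primes in (n, 2n). On the other
   hand the product of the primes p <= n is at most 4^n, and all but s of them are
   at least s + 1 > sqrt (2n), so pi(n) <= sqrt (2n) + 4 ln 2 n / L. These two
   bounds suffice for every n >= 1123, because the coefficient of pi(n) in the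
   theorem is tiny for small n and at most about 0.105 for all n. *)
Require Import Defs.
From mathcomp Require Import all_boot all_order all_algebra.
From mathcomp Require Import all_classical all_reals all_analysis.
From mathcomp Require Import zify ring lra.
Set Implicit Arguments.
Unset Strict Implicit.
Unset Printing Implicit Defensive.
Import Order.TTheory GRing.Theory Num.Theory.
Local Open Scope ring_scope.

(** * Elementary bounds on binomial coefficients and the primorial *)

Definition primorial (n : nat) : nat := (\prod_(0 <= p < n.+1 | prime p) p)%N.

Lemma prod_primes_dvd (N : nat) (r : seq nat) :
  uniq r -> (forall p, p \in r -> prime p -> (p %| N)%N) ->
  (\prod_(p <- r | prime p) p %| N)%N.
Proof.
elim: r => [|q r IH] /=; first by rewrite big_nil dvd1n.
move=> /andP[qr ur] dvdN; rewrite big_cons.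
have IHr : (\prod_(p <- r | prime p) p %| N)%N.
  by apply: IH => // p pr; apply: dvdN; rewrite inE pr orbT.
case: ifP => // pq; rewrite Gauss_dvd; first by rewrite dvdN ?mem_head.
rewrite big_seq_cond; apply: (big_ind (coprime q)) => [|x y cx cy|p /andP[pr pp]].
- exact: coprimen1.
- by rewrite coprimeMr cx.
- by rewrite prime_coprime // dvdn_prime2 //; apply: contraNneq qr => ->.
Qed.

(** Induction on [m]: with N = 2m+1, Pascal's rule applied twice writes C(N+2, m+1) as a sum of four
    entries of row N, none above the middle entry C(N, m). *)
Lemma bin_odd_le (m : nat) : ('C((2 * m).+1, m) <= 4 ^ m)%N.
Proof.
elim: m => [//|m IH]; rewrite expnS; apply: leq_trans (leq_mul (leqnn 4) IH).
have e : ('C((2 * m).+1, m.+1) = 'C((2 * m).+1, m))%N.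
  by rewrite -bin_sub; [congr binomial; lia|lia].
have h : ('C((2 * m).+1, m.-1) <= 'C((2 * m).+1, m))%N.
  case: m {IH e} => [//|m] /=.
  rewrite -(@leq_pmul2l m.+1) // mul_bin_left leq_mul2r; lia.
have -> : ((2 * m.+1).+1 = (2 * m).+1.+2)%N by lia.
move: {IH} (2 * m).+1 e h => N e; rewrite (binS N.+1 m) (binS N m) e.
by case: m {e} => [|m] /=; [rewrite !bin0 | rewrite (binS N m); lia].
Qed.

(** Since (n+1) C(2n+2, n+1) = 2 (2n+1) C(2n, n), the right side grows by the factor 2 (2n+1) / n >=
    4 at each step. *)
Lemma central_bin_ge (n : nat) : (0 < n)%N -> (4 ^ n <= 2 * n * 'C(2 * n, n))%N.
Proof.
case: n => // n _; elim: n => [//|n IH].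
have e : (n.+2 * 'C(2 * n.+2, n.+2) = 2 * (2 * n.+1).+1 * 'C(2 * n.+1, n.+1))%N.
  have h1 := mul_bin_diag (2 * n.+2) n.+1.
  have h2 := mul_bin_down (2 * n.+1).+1 n.+1.
  have E1 : ((2 * n.+2).-1 = (2 * n.+1).+1)%N by lia.
  have E2 : ((2 * n.+1).+1 - n.+1 = n.+2)%N by lia.
  rewrite E1 in h1; rewrite E2 /= in h2.
  by rewrite -h1 -!mulnA h2.
rewrite expnS -(mulnA 2) e; nia.
Qed.

Lemma prime_ndvd_fact (p k : nat) : prime p -> (k < p)%N -> (p %| k`!)%N = false.
Proof.
move=> pp; elim: k => [|k IH] kp; first by rewrite fact0 Euclid_dvd1.
by rewrite factS Euclid_dvdM // IH ?(ltnW kp) // gtnNdvd.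
Qed.

(** An even n > 2 adds no prime. For n = 2m+1, the primes in (m+1, n] all divide C(n, m) <= 4^m, and
    induction covers those up to m+1. *)
Lemma primorial_le (n : nat) : (primorial n <= 4 ^ n)%N.
Proof.
elim/ltn_ind: n => n IH.
have [|n2] := leqP n 2.
  case: n {IH} => [|[|[|n]]] // _; rewrite /primorial /index_iota /=;
  by rewrite ?big_cons ?big_nil.
have [on|en] := boolP (odd n); last first.
  rewrite /primorial big_mkcond big_nat_recr //= ifN.
    rewrite muln1 -big_mkcond; have -> : n = n.-1.+1 by lia.
    by apply: (leq_trans (IH _ _)); [lia|rewrite leq_exp2l //=; lia].
  apply/negP => pn; move: en; case: (even_prime pn) => [e|->//].
  by rewrite e in n2.
set m := n./2; have nE : n = (2 * m).+1 by rewrite /m; lia.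
rewrite /primorial (big_cat_nat (n := m.+2)) //=; last by rewrite nE; lia.
have -> : (4 ^ n = 4 ^ m.+1 * 4 ^ m)%N by rewrite -expnD; congr expn; lia.
apply: leq_mul; first by apply: IH; lia.
apply: leq_trans (bin_odd_le m); rewrite -nE.
apply: dvdn_leq; first by rewrite bin_gt0; lia.
apply: prod_primes_dvd; first exact: iota_uniq.
move=> p; rewrite mem_index_iota => /andP[p1 p2] pp.
have : (p %| n`!)%N by rewrite dvdn_fact // prime_gt0.
rewrite -(@bin_fact n m); last by lia.
rewrite !Euclid_dvdM // => /orP[//|].
by rewrite !prime_ndvd_fact //; lia.
Qed.

(** * Prime factorization of the central binomial coefficient *)

Lemma sum_itv_le (a b l m : nat) :
  (\sum_(l <= k < m) (a < k <= b) <= b - a)%N.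
Proof.
(* Strengthened so that induction on [m] goes through. *)
apply: (@leq_trans (minn b m.-1 - a)); last by lia.
elim: m => [|m IH]; first by rewrite big_geq.
have [ml|lm] := ltnP m l; first by rewrite big_geq.
rewrite big_nat_recr //=; move: IH; set S := bigop _ _ _.
by case: (ltnP a m) => ?; case: (leqP m b) => ? /=; lia.
Qed.

(** Legendre's formula on (2n)! = C(2n, n) n! n!, with the sum for n! extended by zero terms. *)
Lemma logn_central_bin (p n : nat) : prime p ->
  logn p 'C(2 * n, n) =
  (\sum_(1 <= k < (2 * n).+1) ((2 * n) %/ p ^ k - 2 * (n %/ p ^ k)))%N.
Proof.
move=> pp; have n2n : (n <= 2 * n)%N by lia.
have := congr1 (logn p) (bin_fact n2n).
rewrite !lognM ?muln_gt0 ?fact_gt0 ?bin_gt0 //.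
have -> : (2 * n - n = n)%N by lia.
have -> : logn p n`! = (\sum_(1 <= k < (2 * n).+1) n %/ p ^ k)%N.
  rewrite logn_fact // [RHS](big_cat_nat (n := n.+1)) //=.
  rewrite [X in (_ + X)%N]big_nat [X in (_ + X)%N]big1 ?addn0 // => k /andP[nk _].
  by rewrite divn_small // (ltn_trans nk) // ltn_expl // prime_gt1.
rewrite logn_fact // sumnB => [|k _].
  by rewrite -big_distrr /=; lia.
by rewrite leq_divRL ?expn_gt0 ?prime_gt0 // -mulnA leq_mul2l leq_divM.
Qed.

(** Each Legendre term is at most 1 and vanishes once p^k > 2n, so the exponent is at most the
    integer logarithm of 2n in base p. *)
Lemma pfactor_central_bin_le (p n : nat) : prime p -> (0 < n)%N ->
  (p ^ logn p 'C(2 * n, n) <= 2 * n)%N.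
Proof.
move=> pp n0; have p1 := prime_gt1 pp.
apply: (@leq_trans (p ^ trunc_log p (2 * n))); last first.
  by apply: trunc_logP => //; rewrite muln_gt0.
rewrite leq_exp2l // logn_central_bin //.
set T := trunc_log _ _.
apply: (@leq_trans (\sum_(1 <= k < (2 * n).+1) (0 < k <= T)%N)%N).
  rewrite !big_nat; apply: leq_sum => k /andP[k0 _].
  have q0 : (0 < p ^ k)%N by rewrite expn_gt0 prime_gt0.
  have [kT|Tk] := leqP k T.
    have h1 := divn_eq n (p ^ k); have h2 := ltn_pmod n q0.
    have h3 := leq_divM (2 * n) (p ^ k).
    have : (2 * n %/ p ^ k < 2 * (n %/ p ^ k) + 2)%N.
      by rewrite ltn_divLR // {1}h1; nia.
    by lia.
  rewrite divn_small // (leq_trans (trunc_log_ltn (2 * n) p1)) //.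
  by rewrite leq_exp2l.
by rewrite -[leqRHS]subn0 sum_itv_le.
Qed.

(** At k = 1 the term is zero because 2n/p < 3 and n/p >= 1; for k >= 2, p^k >= 3p > 2n. *)
Lemma logn_central_bin_eq0 (p n : nat) : prime p ->
  (2 * n < 3 * p)%N -> (p <= n)%N -> (2 < p)%N -> logn p 'C(2 * n, n) = 0%N.
Proof.
move=> pp np pn p2; rewrite logn_central_bin // big_nat big1 // => k /andP[k1 _].
case: k k1 => [//|[|k]] _; last first.
  rewrite divn_small ?sub0n // (@leq_trans (p ^ 2)) //; first by nia.
  by rewrite leq_exp2l // prime_gt1.
apply/eqP; rewrite subn_eq0 expn1.
have h1 : (2 * n %/ p < 3)%N by rewrite ltn_divLR; lia.
have h2 : (0 < n %/ p)%N by rewrite divn_gt0; lia.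
by lia.
Qed.

Lemma primes_betweenE (m n : nat) :
  primes_between m n = (\sum_(0 <= p < n) (prime p && (m < p)))%N.
Proof.
rewrite /primes_between cardsE -sum1_card big_mkord [LHS]big_mkcond.
by apply: eq_bigr => i _; rewrite unfold_in ltn_ord andbT; case: (_ && _).
Qed.

Lemma prime_piE (n : nat) : prime_pi n = (\sum_(0 <= p < n.+1) prime p)%N.
Proof.
rewrite /prime_pi cardsE -sum1_card big_mkord [LHS]big_mkcond.
by apply: eq_bigr => i _; rewrite unfold_in; case: prime.
Qed.

Lemma prod_pfactor_central_bin (n : nat) : (0 < n)%N ->
  'C(2 * n, n) =
  (\prod_(0 <= p < (2 * n).+1 | prime p) p ^ logn p 'C(2 * n, n))%N.
Proof.
move=> n0; set N := 'C(_, _).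
have N0 : (0 < N)%N by rewrite bin_gt0; lia.
rewrite -[LHS]partnT // (widen_partn _ (leq_maxl N (2 * n))).
rewrite (big_cat_nat (n := (2 * n).+1)) ?ltnS ?leq_maxr //=.
rewrite [X in (_ * X)%N]big_nat_cond [X in (_ * X)%N]big1 ?muln1.
  rewrite [LHS]big_mkcond [RHS]big_mkcond; apply: eq_bigr => p _.
  by case: ifP => // np; rewrite lognE np.
move=> p /andP[/andP[np _] _].
have [pp|npp] := boolP (prime p); last by rewrite lognE (negPf npp).
(* A positive exponent would force p <= 2n. *)
have := pfactor_central_bin_le pp n0; rewrite -/N.
case: (logn p N) => // k; rewrite expnS leqNgt (leq_trans np) // leq_pmulr //.
by rewrite expn_gt0 prime_gt0.
Qed.

Lemma central_bin_le (n s : nat) : (1 < n)%N -> (2 * n < s.+1 ^ 2)%N ->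
  ('C(2 * n, n) <=
    (2 * n) ^ s.-1 * 4 ^ (2 * n %/ 3) * (2 * n) ^ primes_between n (2 * n))%N.
Proof.
move=> n1 ns; have n0 : (0 < n)%N by lia.
have n20 : (0 < 2 * n)%N by lia.
have s1 : (1 < s)%N by nia.
have -> : primes_between n (2 * n) =
    (\sum_(0 <= p < (2 * n).+1) (prime p && (n < p)))%N.
  rewrite primes_betweenE big_nat_recr //= [X in (_ + X)%N](_ : _ = 0%N) ?addn0 //.
  have -> // : prime (2 * n) = false.
  apply/negP => p2n; case: (even_prime p2n); first by lia.
  by rewrite oddM.
rewrite prod_pfactor_central_bin // big_mkcond /=.
(* One factor for each range of primes; where ranges overlap the bound only gets larger. *)
apply: (@leq_trans (\prod_(0 <= p < (2 * n).+1)
  ((2 * n) ^ (1 < p <= s)%N * (if prime p && (p <= 2 * n %/ 3)%N then p else 1)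
   * (2 * n) ^ (prime p && (n < p)))%N)%N).
  rewrite !big_nat; apply: leq_prod => p /andP[_ p2n].
  have [pp|] := boolP (prime p); last first.
    by rewrite /= !muln_gt0 !expn_gt0 n20.
  have p1 := prime_gt1 pp; rewrite p1 /=.
  have L := pfactor_central_bin_le pp n0.
  have [ps|sp] := leqP p s.
    rewrite expn1 -mulnA; apply: leq_trans L _; rewrite leq_pmulr // muln_gt0.
    by rewrite expn_gt0 n20 andbT; case: ifP => // _; apply: prime_gt0.
  rewrite expn0 mul1n.
  (* As p > s, p^2 > 2n, so the exponent is at most 1. *)
  have L1 : (p ^ logn p 'C(2 * n, n) <= p)%N.
    rewrite -{3}(expn1 p) leq_exp2l // -ltnS -(@ltn_exp2l p) //.
    by apply: leq_ltn_trans L _; apply: leq_trans ns _; rewrite leq_exp2r.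
  have [np|pn] := ltnP n p.
    rewrite expn1; apply: leq_trans L _; rewrite leq_pmull //.
    by case: ifP => //; lia.
  rewrite expn0 muln1; case: ifPn => [//|]; rewrite -ltnNge ltn_divLR // => h.
  by rewrite logn_central_bin_eq0 //; lia.
rewrite !big_split /= -!expn_sum.
apply: leq_mul => //; apply: leq_mul.
  by rewrite leq_exp2l -?subn1 ?sum_itv_le //; lia.
rewrite -big_mkcond /=; apply: leq_trans (primorial_le _).
by rewrite /primorial [leqRHS](big_nat_widen _ _ (2 * n).+1) ?ltnS ?leq_div.
Qed.

(** * Exponential inequalities for the prime counts *)

(** Each prime above t contributes more than t to the primorial, and at most t-1 primes are up to
    t. *)
Lemma exp_prime_pi_le (n t : nat) : (0 < t)%N ->
  (t ^ prime_pi n <= t ^ t.-1 * 4 ^ n)%N.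
Proof.
move=> t0; apply: leq_trans (leq_mul (leqnn _) (primorial_le n)).
apply: (@leq_trans (t ^ (\sum_(0 <= p < n.+1) (1 < p <= t)) * primorial n)%N).
  rewrite prime_piE /primorial [X in (_ * X)%N]big_mkcond !expn_sum -big_split /=.
  apply: leq_prod => p _; case: ifP => pp; last by rewrite muln1 expn_gt0 t0.
  rewrite prime_gt1 //= expn1; case: (leqP p t) => h.
    by rewrite expn1 leq_pmulr ?prime_gt0.
  by rewrite expn0 mul1n ltnW.
rewrite leq_mul2r; apply/orP; right.
by case: t t0 => [//|[|t]] _; rewrite ?exp1n // leq_exp2l // -subn1 sum_itv_le.
Qed.

(** The factor 2n from [central_bin_ge] raises the exponent s-1 of [central_bin_le] to s. *)
Lemma exp4_le_primes_between (n s : nat) : (1 < n)%N -> (0 < s)%N ->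
  (2 * n < s.+1 ^ 2)%N ->
  (4 ^ n <= 4 ^ (2 * n %/ 3) * (2 * n) ^ (s + primes_between n (2 * n)))%N.
Proof.
move=> n1 s0 ns; apply: (leq_trans (central_bin_ge (ltnW n1))).
have := leq_mul (leqnn (2 * n)) (central_bin_le n1 ns).
move=> /leq_trans; apply; case: s s0 {ns} => // s _ /=.
by rewrite addSn expnS expnD; lia.
Qed.

(** * Numerical bounds and inequalities for the logarithm *)

Lemma expR_ge_partial_sum (R : realType) (x : R) (n : nat) :
  0 <= x -> \sum_(0 <= i < n) x ^+ i / i`!%:R <= expR x.
Proof.
move=> x0; rewrite /expR.
apply: (nondecreasing_cvgn_le _ (is_cvg_series_exp_coeff x) n).
by apply: nondecreasing_series => i _ _; apply: exp_coeff_ge0.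
Qed.

Lemma ln2_le (R : realType) : ln 2 <= 695 / 1000 :> R.
Proof.
rewrite -ler_expR lnK ?posrE//.
(* Five terms of the exponential series at 0.695 already exceed 2. *)
apply: le_trans (@expR_ge_partial_sum R (695 / 1000) 5 _); last by lra.
rewrite /index_iota /= !big_cons big_nil !factS fact0 /=.
lra.
Qed.

Lemma ln2_ge (R : realType) : 2 / 3 <= ln 2 :> R.
Proof.
rewrite -[X in X <= _]opprK lerNl -lnV ?posrE// -ler_expR lnK ?posrE ?invr_gt0//.
(* exp(-2/3) = exp(-1/24)^16 >= (23/24)^16 >= 1/2. *)
have -> : - (2 / 3) = 16%:R * (- (1 / 24)) :> R by lra.
rewrite expRM_natl.
have h : 23 / 24 <= expR (- (1 / 24)) :> R by apply: le_trans (expR_ge1Dx _); lra.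
apply: (@le_trans _ _ ((23 / 24) ^+ 16)); first by lra.
by rewrite lerXn2r // nnegrE; [lra|exact: expR_ge0].
Qed.

Lemma ln_le_tangent (R : realType) (a x : R) :
  0 < a -> 0 < x -> ln x <= ln a + x / a - 1.
Proof.
move=> a0 x0; have xa : 0 < x / a by rewrite divr_gt0.
have := @le_ln1Dx R (x / a - 1) ltac:(lra).
by rewrite addrC subrK ln_div ?posrE //; lra.
Qed.

Lemma ler_ln_nat (R : realType) (m n : nat) :
  (0 < m)%N -> (m <= n)%N -> ln m%:R <= ln n%:R :> R.
Proof.
by move=> m0 mn; rewrite ler_ln ?posrE ?ltr0n ?ler_nat // (leq_trans m0).
Qed.

Lemma ln4E (R : realType) : ln 4 = 2 * ln 2 :> R.
Proof. by rewrite (_ : 4 = 2 ^+ 2) ?lnXn ?mulr_natl //; lra. Qed.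

(** * Real bounds on the prime counts and their comparison *)

Lemma sqrt_nat_bounds (R : realType) (n : nat) : (0 < n)%N ->
  exists s : nat, [/\ (0 < s)%N, (n < s.+1 ^ 2)%N & s%:R <= Num.sqrt n%:R :> R].
Proof.
move=> n0; have S0 : 0 <= Num.sqrt n%:R :> R by exact: sqrtr_ge0.
have /andP[s1 s2] := truncn_itv S0.
have ns : (n < (Num.truncn (Num.sqrt n%:R : R)).+1 ^ 2)%N.
  rewrite -(ltr_nat R) natrX -[ltLHS]sqr_sqrtr ?ler0n //.
  by rewrite ltrXn2r // nnegrE.
exists (Num.truncn (Num.sqrt n%:R : R)); split => //.
by rewrite truncn_gt0 -[leLHS]sqrtr1 ler_wsqrtr ?ler1n.
Qed.

(** Logarithm of [exp4_le_primes_between]: 4^(2n/3) cancels two thirds of 4^n, leaving (n/3) ln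
    4. *)
Lemma primes_between_ge (R : realType) (n : nat) : (1 < n)%N ->
  2 / 3 * ln 2 * n%:R
  <= ln (2 * n)%:R * (Num.sqrt (2 * n)%:R + (primes_between n (2 * n))%:R) :> R.
Proof.
move=> n1; have n20 : (0 < 2 * n)%N by lia.
have [s [s0 ns sS]] := sqrt_nat_bounds R n20.
have p4 : (0 < 4 ^ n)%N by rewrite expn_gt0.
have := ler_ln_nat R p4 (exp4_le_primes_between n1 s0 ns).
rewrite natrM !natrX lnM ?posrE ?exprn_gt0 ?ltr0n // !lnXn ?ltr0n // ln4E.
have L0 : 0 <= ln (2 * n)%:R :> R by rewrite ln_ge0 // ler1n.
have l0 := @ln2_ge R.
rewrite -!(mulr_natr (_ * _)) -(mulr_natr (ln _)) natrD.
have q : ((2 * n) %/ 3)%:R <= 2 / 3 * n%:R :> R.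
  have := leq_divM (2 * n) 3; rewrite -(ler_nat R) !natrM; lra.
set q' := (_ %/ _)%:R in q *; set L := ln _ in L0 *.
move=> h; have h1 : 2 * ln 2 * q' <= 2 * ln 2 * (2 / 3 * n%:R) by rewrite ler_wpM2l; lra.
have h2 : L * s%:R <= L * Num.sqrt (2 * n)%:R by rewrite ler_wpM2l.
by nra.
Qed.

(** [exp_prime_pi_le] at base s+1 gives (pi(n) - s) ln(s+1) <= n ln 4, and ln(2n) <= 2 ln(s+1). *)
Lemma prime_pi_le (R : realType) (n : nat) : (0 < n)%N ->
  ln (2 * n)%:R * (prime_pi n)%:R
  <= ln (2 * n)%:R * Num.sqrt (2 * n)%:R + 4 * ln 2 * n%:R :> R.
Proof.
move=> n0; have n20 : (0 < 2 * n)%N by lia.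
have [s [s0 ns sS]] := sqrt_nat_bounds R n20.
have L0 : 0 <= ln (2 * n)%:R :> R by rewrite ln_ge0 // ler1n.
have Lt : ln (2 * n)%:R <= 2 * ln s.+1%:R :> R.
  rewrite mulr_natl -lnXn ?ltr0n // ler_ln ?posrE ?exprn_gt0 ?ltr0n //.
  by rewrite -natrX ler_nat ltnW.
have pt : (0 < s.+1 ^ prime_pi n)%N by rewrite expn_gt0.
have := ler_ln_nat R pt (exp_prime_pi_le n (ltn0Sn s)).
rewrite natrM !natrX lnM ?posrE ?exprn_gt0 ?ltr0n // !lnXn ?ltr0n //= ln4E.
have l0 := @ln2_ge R.
rewrite -!(mulr_natr (ln _)) -(mulr_natr (_ * _)).
set L := ln (2 * n)%:R in L0 Lt *; set t := ln s.+1%:R in Lt *.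
move=> h; have h2 : L * s%:R <= L * Num.sqrt (2 * n)%:R by rewrite ler_wpM2l.
(* Multiplying ln(2n) <= 2 ln(s+1) by pi(n) - s requires its sign. *)
have [ps|sp] := lerP (prime_pi n)%:R (s%:R : R).
  have : L * (prime_pi n)%:R <= L * s%:R by rewrite ler_wpM2l.
  have : 0 <= ln 2 * n%:R :> R by rewrite mulr_ge0 //; lra.
  lra.
have : L * ((prime_pi n)%:R - s%:R) <= 2 * t * ((prime_pi n)%:R - s%:R).
  by rewrite ler_wpM2r // subr_ge0 ltW.
lra.
Qed.

(* Here [S] is the square root of [2 * n], and [4739 / 100] is just below its value
   at [n = 1123]. *)
Lemma bertrand_numeric (R : realType) (S L : R) : 4739 / 100 <= S ->
  L = 2 * ln S ->
  (2 * ln 2 - chebC R - 2 * ln 2 ^+ 2 / L) * (2 * L + 4 * ln 2 * S)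
  <= chebC R * (2 / 3 * ln 2 * S - 2 * L).
Proof.
move=> S0 LE; have Sp : 0 < S by lra.
have := @ln2_ge R; have := @ln2_le R; set l : R := ln 2 => l1 l2.
set a := _ - _ - _.
have pow k : ln (2 ^+ k) = k%:R * l :> R by rewrite lnXn // mulr_natl.
(* Tangent to ln at [2 ^+ k]; k = 6 and k = 7 below turn L into a linear bound in S. *)
have tan k : L <= 2 * (k%:R * l + S / 2 ^+ k - 1).
  rewrite LE -pow; have := @ln_le_tangent R (2 ^+ k) S.
  by rewrite exprn_gt0 // => /(_ isT Sp); lra.
have L0 : 0 < L by rewrite LE mulr_gt0 // ln_gt0; lra.
have /andP[C1 C2] : 1255 / 1000 <= chebC R <= 1256 / 1000.
  by rewrite /chebC (exprS _ 4) (exprS _ 3); apply/andP; split; lra.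
have lS1 : l * S <= 695 / 1000 * S by rewrite ler_pM2r.
have lS2 : 2 / 3 * S <= l * S by rewrite ler_pM2r.
have X0 : 0 < 2 * L + 4 * l * S by lra.
(* Replaces [a] by an upper bound and [chebC R] by the lower bound 1.255. *)
have scale c : a <= c -> 0 <= 2 / 3 * l * S - 2 * L ->
    c * (2 * L + 4 * l * S) <= 1255 / 1000 * (2 / 3 * l * S - 2 * L) ->
    a * (2 * L + 4 * l * S) <= chebC R * (2 / 3 * l * S - 2 * L).
  move=> ac Y0 h; apply: le_trans (le_trans _ h) _.
    by rewrite ler_wpM2r // ltW.
  by rewrite ler_wpM2r.
(* For [L <= 15 ln 2] (that is, [2 * n <= 2 ^ 15]) the coefficient [a] is at most
   0.043; beyond, [a < 2 ln 2 - C] is enough because [L / S] is smaller. *)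
have [Ll|Ll] := lerP L (15 * l).
  have t6 := tan 6%N.
  have Lu : 2 * L <= 331 / 1000 * S by lra.
  have ha : a <= 43 / 1000.
    have : 2 * l / 15 <= 2 * l ^+ 2 / L.
      by rewrite ler_pdivlMr // -mulrA mulrC; nra.
    rewrite /a; lra.
  by apply: (scale _ ha); lra.
have t7 := tan 7%N.
(* 181^2 = 32761 is just below 2^15. *)
have S181 : 181 <= S.
  rewrite leNgt; apply/negP => h.
  have : ln (S ^+ 2) <= ln (2 ^+ 15).
    by rewrite ler_ln ?posrE ?exprn_gt0 //; nra.
  by rewrite lnXn // pow mulrC -mulr_natl; lra.
have Lu : 2 * L <= 117 / 1000 * S by lra.
have ha : a <= 135 / 1000.
  have : 0 <= 2 * l ^+ 2 / L by rewrite divr_ge0 ?(ltW L0) // mulr_ge0 // sqr_ge0.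
  rewrite /a; lra.
by apply: (scale _ ha); lra.
Qed.

Theorem theorem5 (R : realType) (n : nat) (hn : (1123 <= n)%N) :
  let C : R := chebC R in
  Num.floor (1 / C * (ln 4 - C - ln 2 * ln 4 / ln (2 * n)%:R)
             * (prime_pi n)%:R)
  <= (primes_between n (2 * n))%:Z.
Proof.
cbv zeta; set C := chebC R; have C0 : 0 < C by rewrite /C /chebC; lra.
have n1 : (1 < n)%N by lia.
have hB := primes_between_ge R n1; have hpi := prime_pi_le R (ltnW n1).
set B := primes_between _ _ in hB *; set p := (prime_pi n)%:R in hpi *.
suff h : 1 / C * (ln 4 - C - ln 2 * ln 4 / ln (2 * n)%:R) * p <= B%:R.
  by rewrite -(ler_int R); apply: le_trans (floor_le _) h.
rewrite ln4E.
have -> : ln 2 * (2 * ln 2) = 2 * ln 2 ^+ 2 :> R by rewrite expr2; lra.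
rewrite -mulrA mul1r ler_pdivrMl //.
set S := Num.sqrt _ in hB hpi.
have SS : S ^+ 2 = 2 * n%:R by rewrite sqr_sqrtr ?ler0n // natrM.
have S0 : 0 <= S by exact: sqrtr_ge0.
have hn' : 1123 <= n%:R :> R by rewrite (ler_nat R 1123).
have S1 : 4739 / 100 <= S by nra.
have LE : ln (2 * n)%:R = 2 * ln S.
  by rewrite natrM -SS lnXn ?mulr_natl //; lra.
have := bertrand_numeric S1 LE; rewrite -/C.
set L := ln (2 * n)%:R in hB hpi LE *; set a := _ - _ - _ => main.
have L0 : 0 < L by rewrite LE mulr_gt0 // ln_gt0; lra.
(* The upper bound on pi(n) helps only against a positive coefficient; otherwise the left side is at
   most 0. *)
have [a0|a0] := lerP a 0.
  apply: (@le_trans _ _ 0); first by rewrite mulr_le0_ge0.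
  by rewrite mulr_ge0 // ltW.
rewrite -(ler_pM2l L0).
have h1 : a * (L * p) <= a * (L * S + 4 * ln 2 * n%:R) by rewrite ler_pM2l.
have h2 : C * (2 / 3 * ln 2 * n%:R) <= C * (L * (S + B%:R)) by rewrite ler_pM2l.
have nE : n%:R = S ^+ 2 / 2 :> R by lra.
(* With n = S^2/2, [main] times S is twice the inequality needed. *)
have := ler_wpM2r S0 main.
rewrite nE in h1 h2; lra.
Qed.
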